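(* Let $X_1,X_2,Y$ be real Banach spaces and let $X=X_1\oplus_\infty X_2$. If $T: X\to Y$ is a strong Daugavet operator on $X$, then its restrictions $T_1: X_1\to Y$, $T_1x_1=T(x_1,0)$, and $T_2: X_2\to Y$, $T_2x_2=T(0,x_2)$, are strong Daugavet operators on $X_1$ and $X_2$, respectively.
   Context: All Banach spaces are real; $S(X)$ denotes the unit sphere of $X$. $X_1\oplus_\infty X_2$ is the direct sum with norm $\|(x_1,x_2)\|=\max\{\|x_1\|,\|x_2\|\}$. A bounded linear operator $T$ from a Banach space $X$ to some Banach space $Y$ is a strong Daugavet operator (on $X$) if for all $x,y\in S(X)$ and every $\varepsilon>0$ there is $z\in S(X)$ with $\|x+z\|\ge 2-\varepsilon$ and $\|T(y-z)\|\le\varepsilon$. *)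

(* Defs.v *)
From HB Require Import structures.
From mathcomp Require Import all_boot all_order all_algebra.
From mathcomp Require Import all_classical all_reals all_analysis.

Set Implicit Arguments.
Unset Strict Implicit.
Unset Printing Implicit Defensive.

Import Order.TTheory GRing.Theory Num.Theory.
Import numFieldNormedType.Exports.

Local Open Scope classical_set_scope.
Local Open Scope ring_scope.

(* The library norms (X1 * X2)%type by the maximum of the two norms
   (prod_normE), so this type is the l_infty direct sum of X1 and X2. The
   library does not declare it complete. *)
Section prod_complete.
Context {R : realType} {X1 X2 : completeNormedModType R}.

(* Triggers the pointed topological and uniform structures, which Complete
   requires and which the library does not derive on products. *)
HB.instance Definition _ := Pointed.on (X1 * X2)%type.

Lemma prod_cauchy_cvg (F : set_system (X1 * X2)%type) :
  ProperFilter F -> cauchy F -> cvg F.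
Proof.
move=> FF /cauchy_ballP Fc.
have c1 : cvg (fst @ F).
  apply: cauchy_cvg; apply/cauchy_ballP => e e0.
  have [[A B] /= [FA FB] AB] := Fc e e0.
  exists (fst @` A, fst @` B) => /=.
    by split; [apply: filterS FA|apply: filterS FB] => p Ap; exists p.
  by move=> [_ _] /= [[p Ap <-] [q Bq <-]]; case: (AB (p, q)).
have c2 : cvg (snd @ F).
  apply: cauchy_cvg; apply/cauchy_ballP => e e0.
  have [[A B] /= [FA FB] AB] := Fc e e0.
  exists (snd @` A, snd @` B) => /=.
    by split; [apply: filterS FA|apply: filterS FB] => p Ap; exists p.
  by move=> [_ _] /= [[p Ap <-] [q Bq <-]]; case: (AB (p, q)).
apply/cvg_ex; exists (lim (fst @ F), lim (snd @ F)).
apply: cvg_trans (cvg_pair c1 c2).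
by apply: near_eq_cvg; apply: nearW => -[].
Qed.

HB.instance Definition _ :=
  Uniform_isComplete.Build (X1 * X2)%type prod_cauchy_cvg.

End prod_complete.

Section strong_daugavet.
Context {R : realType}.

Definition unit_sphere (X : normedModType R) : set X := [set x | `|x| = 1].

(* bounded_fun_norm T: T maps norm-bounded sets to norm-bounded sets. *)
Definition strong_daugavet (X Y : completeNormedModType R) (T : X -> Y) : Prop :=
  [/\ linear T, bounded_fun_norm T &
      forall x y, unit_sphere x -> unit_sphere y -> forall eps : R, 0 < eps ->
        exists z, [/\ unit_sphere z, 2 - eps <= `|x + z|
                    & `|T (y - z)| <= eps]].

End strong_daugavet.

(* Main.v *)
Require Import Defs.
From HB Require Import structures.
From mathcomp Require Import all_boot all_order all_algebra.
From mathcomp Require Import all_classical all_reals all_analysis.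
From mathcomp Require Import lra.

Set Implicit Arguments.
Unset Strict Implicit.
Unset Printing Implicit Defensive.

Import Order.TTheory GRing.Theory Num.Theory.
Import numFieldNormedType.Exports.

Local Open Scope ring_scope.

(** A strong Daugavet operator T on the max-sum of X1 and X2, applied to the
    unit vectors (x, 0) and (y, u) with |y| = 1 and |u| <= 1, returns a unit
    vector (z, v) with T (z, v) close to T (y, u); as the distance of (x, 0)
    from - (z, v) is a maximum whose second entry is at most 1, it is the first
    entry |x + z| that is close to 2. What spoils z as a witness for the
    restriction to X1 is the error term T (0, u - v), which has no reason to be
    small.

    The remedy is to feed the output v back as the next u: starting from u_0 = 0,
    one gets z_1, u_1, z_2, u_2, ... with T (y - z_i, u_(i-1) - u_i) small. On
    averaging, the second components telescope:
      T (y - A, 0) is close to T (0, u_n) / n,   where A = (z_1 + ... + z_n) / n,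
    and the right-hand side is O(1 / n), because T is bounded. To keep |x + A|
    almost 2, the i-th step uses the direction of x + z_1 + ... + z_(i-1)
    in place of x, so that the norm of x + z_1 + ... + z_n is almost n + 1, the
    largest possible value ([telescoping_sum]). Near-maximality of the norm of a
    sum survives rescaling the summands ([norm_comb_ge]), so |x + A| is almost
    2; then |A| is almost 1, and normalizing A gives the witness
    ([strong_daugavet_restr_left]). The second summand follows by exchanging the
    two ([strong_daugavet_swap]). *)

(** Two vectors whose sum is almost as long as the bounds p and q allow span a
    cone on which the norm is almost additive: c (u + v) exceeds a u + b v by
    (c - a) u + (c - b) v, whose norm is at most (c - a) p + (c - b) q. *)
Lemma norm_comb_ge (R : realType) (X : normedModType R) (u v : X)
    (p q a b c eta : R) :
  `|u| <= p -> `|v| <= q -> p + q - eta <= `|u + v| ->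
  0 <= a <= c -> 0 <= b <= c ->
  a * p + b * q - c * eta <= `|a *: u + b *: v|.
Proof.
move=> up vq uv /andP[a0 ac] /andP[b0 bc].
have E : c *: (u + v) = (a *: u + b *: v) + ((c - a) *: u + (c - b) *: v).
  by rewrite addrACA -!scalerDl !subrKC scalerDr.
have c0 : 0 <= c by apply: le_trans ac.
have : c * (p + q - eta) <= `|c *: (u + v)|.
  by rewrite normrZ ger0_norm// ler_wpM2l.
rewrite E => /le_trans/(_ (ler_normD _ _)) h1.
have h2 := ler_normD ((c - a) *: u) ((c - b) *: v).
rewrite !normrZ !ger0_norm ?subr_ge0// in h2.
have h3 : (c - a) * `|u| <= (c - a) * p by rewrite ler_wpM2l ?subr_ge0.
have h4 : (c - b) * `|v| <= (c - b) * q by rewrite ler_wpM2l ?subr_ge0.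
lra.
Qed.

Lemma unit_pairl (R : realType) (X1 X2 : completeNormedModType R)
    (y : X1) (u : X2) :
  `|y| = 1 -> `|u| <= 1 -> unit_sphere ((y, u) : (X1 * X2)%type).
Proof. by move=> y1 u1; rewrite /unit_sphere /= prod_normE /= y1 max_l. Qed.

(** S is z_1 + ... + z_n and u is u_n in the iteration described at the top;
    the second components of the n approximations T (z_i, u_i) ~ T (y, u_(i-1))
    telescope to - u. The error d is arbitrary for each n, so that the
    induction can spend half of it on the first n steps and half on the last. *)
Lemma telescoping_sum (R : realType) (X1 X2 Y : completeNormedModType R)
    (T : {linear (X1 * X2)%type -> Y}) (x y : X1) (n : nat) (d : R) :
  strong_daugavet T -> `|x| = 1 -> `|y| = 1 -> 0 < d <= 1/2 ->
  exists (S : X1) (u : X2), [/\ `|S| <= n%:R, n%:R + 1 - d <= `|x + S|,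
    `|u| <= 1 & `|T (n%:R *: y - S, - u)| <= d].
Proof.
move=> sdT x1 y1; elim: n d => [|n IH] d /andP[d0 d1].
  exists 0, 0; rewrite !normr0 scale0r subr0 oppr0 addr0 x1.
  by rewrite linear0 normr0; split => //; lra.
have n0 : 0 <= n%:R :> R by [].
have d2 : 0 < d / 2 <= 1/2 by lra.
have [S [u [Sn xS u1 TS]]] := IH _ d2.
set w := x + S in xS *; pose a := `|w|.
have aE : a = `|w| by [].
have an : a <= n%:R + 1.
  by have := ler_normD x S; rewrite -/w x1 -aE; lra.
have a0 : 0 < a by rewrite aE; lra.
(* norm_comb_ge is used with c = n + 1, which multiplies eta by n + 1. *)
pose eta := d / 2 / (n%:R + 1).
have etaE : (n%:R + 1) * eta = d / 2 by rewrite /eta mulrC divfK//; lra.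
have eta0 : 0 < eta by rewrite /eta divr_gt0//; lra.
have eta1 : eta <= d / 2.
  by rewrite -etaE; apply: ler_peMl; lra.
have w1 : `|a^-1 *: w| = 1.
  by rewrite normrZ ger0_norm ?invr_ge0 ?ltW// -aE mulVf// gt_eqF.
have [_ _ sd] := sdT.
have sw : unit_sphere ((a^-1 *: w, 0) : (X1 * X2)%type).
  by apply: unit_pairl; rewrite ?normr0.
have [[z v] [/= z1 xz Tz]] := sd _ _ sw (unit_pairl y1 u1) _ eta0.
move: z1; rewrite /unit_sphere /= prod_normE /= => z1.
have zle : `|z| <= 1 by rewrite -z1 le_max lexx.
have vle : `|v| <= 1 by rewrite -z1 le_max lexx orbT.
(* The second entry of the maximum is |v| <= 1 < 2 - eta. *)
have {}xz : 1 + 1 - eta <= `|a^-1 *: w + z|.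
  move: xz; rewrite prod_normE /= add0r le_max => /orP[|]; lra.
exists (S + z), v; split => //.
- by rewrite -natr1 (le_trans (ler_normD _ _))// lerD.
- have ale : 0 <= a <= n%:R + 1 by rewrite ltW.
  have w1le : `|a^-1 *: w| <= 1 by rewrite w1.
  have ole : 0 <= (1 : R) <= n%:R + 1 by lra.
  have := norm_comb_ge w1le zle xz ale ole.
  rewrite scalerA mulfV ?gt_eqF// !scale1r etaE addrA -[n.+1%:R]natr1 -/w; lra.
- have -> : (n.+1%:R *: y - (S + z), - v) =
      (n%:R *: y - S, - u) + ((y, u) - (z, v)) :> (X1 * X2)%type.
    congr pair => /=; last by rewrite addrA addNr add0r.
    by rewrite -natr1 scalerDl scale1r opprD addrACA.
  rewrite linearD (le_trans (ler_normD _ _))//; lra.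
Qed.

Lemma strong_daugavet_restr_left (R : realType)
    (X1 X2 Y : completeNormedModType R) (T : (X1 * X2)%type -> Y) :
  strong_daugavet T -> strong_daugavet (fun x1 : X1 => T (x1, 0)).
Proof.
move=> sdT; have [lT bT _] := sdT.
pose TL : {linear (X1 * X2)%type -> Y} :=
  HB.pack T (GRing.isLinear.Build R _ _ _ T lT).
have TD p q : T (p + q) = T p + T q by exact: (linearD TL).
have TZ a p : T (a *: p) = a *: T p by exact: (linearZ_LR TL).
split.
- move=> a x y /=; rewrite -lT; congr (T _).
  by congr pair; rewrite /= scaler0 addr0.
- move=> r; have [M MT] := bT r; exists M => x xr; apply: MT.
  by rewrite prod_normE /= normr0 max_l.
move=> x y; rewrite /unit_sphere /= => x1 y1 eps eps0.
(* The bound on T (y - z, 0) is d M from replacing A by z, plus (d + M) / n from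
   averaging; d and n make each at most eps / 2. *)
have [M MT] := bT 1.
have M0 : 0 <= M.
  by apply: le_trans (MT 0 _); rewrite ?normr0.
pose d := Num.min (1/2) (eps / (2 * (M + 2))).
have d12 : d <= 1/2 by rewrite ge_min lexx.
have d0 : 0 < d by rewrite lt_min !divr_gt0//; lra.
have dM : d * (2 * (M + 2)) <= eps.
  by rewrite -ler_pdivlMr ?ge_min ?lexx ?orbT//; lra.
pose n := (Num.truncn (2 * (M + 1) / eps)).+1.
have nM : (M + 1) / n%:R <= eps / 2.
  have : 2 * (M + 1) / eps < n%:R by apply: truncnS_gt.
  rewrite ltr_pdivrMr// => h; rewrite ler_pdivrMr//; lra.
have nn0 : 0 < n%:R :> R by [].
have dd : 0 < d <= 1/2 by rewrite d0.
have [S [u [Sn xS u1 TS]]] := telescoping_sum (T := TL) n sdT x1 y1 dd.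
have n1 : 1 <= n%:R :> R by rewrite ler1n.
pose A := n%:R^-1 *: S.
have xA : 2 - d <= `|x + A|.
  have xS' : 1 + n%:R - d <= `|x + S| by lra.
  have x1le : `|x| <= 1 by rewrite x1.
  have le11 : 0 <= (1 : R) <= 1 by rewrite ler01 lexx.
  have nV : 0 <= (n%:R^-1 : R) <= 1 by rewrite invr_ge0 invf_le1// n1 ltW.
  have := norm_comb_ge x1le Sn xS' le11 nV.
  rewrite scale1r mulVf ?gt_eqF// -/A; lra.
have A1 : `|A| <= 1.
  rewrite /A normrZ ger0_norm ?invr_ge0 ?(ltW nn0)//.
  by rewrite [leLHS]mulrC ler_pdivrMr// mul1r.
have Ad : 1 - d <= `|A|.
  have := ler_normD x A; rewrite x1; lra.
have A0 : 0 < `|A| by lra.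
pose z := `|A|^-1 *: A.
have z1 : `|z| = 1.
  by rewrite normrZ ger0_norm ?invr_ge0 ?ltW// mulVf// gt_eqF.
have Az : A = `|A| *: z by rewrite scalerA mulfV ?gt_eqF// scale1r.
have AzE : A - z = (`|A| - 1) *: z by rewrite scalerBl scale1r -Az.
have nAz : `| `|A| - 1| <= d by rewrite ler_norml; lra.
exists z; split => //.
- have : `|x + A| <= `|x + z| + `|A - z|.
    have -> : x + A = (x + z) + (A - z) by rewrite addrACA subrr addr0.
    exact: ler_normD.
  rewrite AzE normrZ z1 mulr1; have : d * 4 <= eps by nra.
  lra.
- have -> : (y - z, 0) = n%:R^-1 *: ((n%:R *: y - S, - u) + (0, u))
       + (`|A| - 1) *: (z, 0) :> (X1 * X2)%type.
    congr pair => /=; last by rewrite addNr !scaler0 addr0.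
    rewrite addr0 scalerBr scalerA mulVf ?gt_eqF// scale1r -AzE -/A.
    by rewrite addrA subrK.
  rewrite TD !TZ TD.
  rewrite (le_trans (ler_normD _ _))//.
  rewrite [`|_ *: (_ + _)|]normrZ [`|_ *: T (z, 0)|]normrZ.
  rewrite [`|n%:R^-1|]ger0_norm ?invr_ge0//.
  have Mu : `|T (0, u)| <= M.
    by apply: MT; rewrite prod_normE /= normr0 max_r.
  have Mz : `|T (z, 0)| <= M.
    by apply: MT; rewrite prod_normE /= normr0 z1 max_l.
  have h1 : `| `|A| - 1| * `|T (z, 0)| <= d * M by apply: ler_pM.
  have h2 : n%:R^-1 * `|T (n%:R *: y - S, - u) + T (0, u)| <= (M + 1) / n%:R.
    rewrite mulrC ler_wpM2r ?invr_ge0//.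
    rewrite (le_trans (ler_normD _ _))//; lra.
  have : d * M <= eps / 2 by lra.
  lra.
Qed.

Lemma strong_daugavet_swap (R : realType) (X1 X2 Y : completeNormedModType R)
    (T : (X1 * X2)%type -> Y) :
  strong_daugavet T -> strong_daugavet (fun p : (X2 * X1)%type => T (p.2, p.1)).
Proof.
have swap_norm (U V : completeNormedModType R) (p : (U * V)%type) :
  `|((p.2, p.1) : (V * U)%type)| = `|p| by rewrite !prod_normE /= maxC.
move=> [lT bT sd]; split.
- by move=> a p q /=; rewrite -lT.
- move=> r; have [M MT] := bT r; exists M => p pr.
  by apply: MT; rewrite swap_norm.
move=> x y; rewrite /unit_sphere /= => x1 y1 eps eps0.
have [||[z1 z2] [zS xz Tz]] := sd (x.2, x.1) (y.2, y.1) _ _ _ eps0.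
- by rewrite /unit_sphere /= swap_norm.
- by rewrite /unit_sphere /= swap_norm.
exists (z2, z1); split => //.
- by rewrite -swap_norm.
- by rewrite -swap_norm.
Qed.

Theorem theorem3p4 (R : realType) (X1 X2 Y : completeNormedModType R)
    (T : (X1 * X2)%type -> Y) :
  strong_daugavet T ->
  strong_daugavet (fun x1 : X1 => T (x1, 0)) /\
  strong_daugavet (fun x2 : X2 => T (0, x2)).
Proof.
move=> sdT; split; first exact: strong_daugavet_restr_left.
exact: strong_daugavet_restr_left (strong_daugavet_swap sdT).
Qed.
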